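(* Let $A,B,H,Q\in\mathbb{R}^{n\times n}$ with $A$ nonsingular, let $A=M-N$ with $M$ nonsingular, let $Q=Q_1-Q_2$ with $Q_1$ nonsingular, let $\widehat Q\in\mathbb{R}^{n\times n}$ be nonsingular, and let $\hat\alpha>0$, $\hat\beta>0$, $\theta>0$. Let $$a=\Vert M^{-1}N\Vert,\ c=\Vert M^{-1}BQ\Vert,\ d=\Vert Q_1^{-1}Q_2\Vert,\ \alpha=\Vert Q_1^{-1}\Vert,\ \beta=\Vert Q_1^{-1}H\Vert,$$ $$T=\begin{bmatrix} a & c\\ a(\theta\alpha+\beta)+\beta & c(\theta\alpha+\beta)+\theta d+|1-\theta|\end{bmatrix},$$ $$T_{\rm MGSOR}=\begin{bmatrix}|1-\hat\alpha| & \hat\alpha\Vert A^{-1}B\widehat Q\Vert\\ \hat\beta|1-\hat\alpha|\Vert\widehat Q^{-1}\Vert & \hat\alpha\hat\beta\Vert A^{-1}B\widehat Q\Vert\Vert\widehat Q^{-1}\Vert+|1-\hat\beta|\end{bmatrix}.$$ Assume that $$|1-\hat\alpha||1-\hat\beta|<1\quad\text{and}\quad \hat\alpha\hat\beta\Vert A^{-1}B\widehat Q\Vert\Vert\widehat Q^{-1}\Vert<(1-|1-\hat\alpha|)(1-|1-\hat\beta|),$$ and that $T$ is irreducible. If $$a<|1-\hat\alpha|,\quad c<\hat\alpha\Vert A^{-1}B\widehat Q\Vert,\quad \alpha c+d<1,$$ $$\beta\big((a+1)(1-d)-\alpha c\big)-\hat\beta|1-\hat\alpha|\Vert\widehat Q^{-1}\Vert(1-\alpha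 c-d)<a\alpha\left[|1-\hat\beta|+\hat\alpha\hat\beta\Vert A^{-1}B\widehat Q\Vert\Vert\widehat Q^{-1}\Vert-1\right],$$ and $\tilde\mu<\theta<\min\{\tilde\nu,\Delta\}$, where $$\tilde\mu=\frac{1+\beta c-\left(|1-\hat\beta|+\hat\alpha\hat\beta\Vert A^{-1}B\widehat Q\Vert\Vert\widehat Q^{-1}\Vert\right)}{1-(\alpha c+d)},\quad \tilde\nu=\frac{1-\beta c+|1-\hat\beta|+\hat\alpha\hat\beta\Vert A^{-1}B\widehat Q\Vert\Vert\widehat Q^{-1}\Vert}{1+\alpha c+d},$$ $$\Delta=\frac{\hat\beta|1-\hat\alpha|\Vert\widehat Q^{-1}\Vert-(a+1)\beta}{a\alpha},$$ then $\rho(T)<\rho(T_{\rm MGSOR})<1$.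
   Context: $\Vert\cdot\Vert$ is the matrix 2-norm and $\rho(\cdot)$ is the spectral radius. ''Irreducible'' is the usual notion for square (nonnegative) matrices. The matrices $T$ and $T_{\rm MGSOR}$ are the $2\times2$ nonnegative matrices bounding the norms of successive differences of the iterates of the GRMS method (with parameters $M,N,Q,Q_1,Q_2,H,\theta$) and of the MGSOR method (with parameters $\hat\alpha=\alpha_{\rm MGSOR}$, $\hat\beta=\beta_{\rm MGSOR}$, $\widehat Q=Q_{\rm MGSOR}$), respectively. *)

(* Defs.v *)
From mathcomp Require Import all_boot all_order all_algebra all_fingroup.
From mathcomp Require Import complex.
From mathcomp Require Import classical_sets reals.

Set Implicit Arguments.
Unset Strict Implicit.
Unset Printing Implicit Defensive.

Import Order.TTheory GRing.Theory Num.Theory.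
Local Open Scope classical_set_scope.
Local Open Scope complex_scope.
Local Open Scope ring_scope.

Definition vnorm2 (R : realType) (n : nat) (x : 'cV[R]_n) : R :=
  Num.sqrt (\sum_(i < n) x i 0 ^+ 2).

(* The supremum is over the unit ball rather than the unit sphere, so that
   the set is nonempty also for n = 0; for n > 0 the two suprema agree. *)
Definition norm2 (R : realType) (m n : nat) (A : 'M[R]_(m, n)) : R :=
  sup [set vnorm2 (A *m x) | x in [set x : 'cV[R]_n | vnorm2 x <= 1]].

(* All complex eigenvalues count, hence the cast of the real matrix to R[i].
   The set of moduli is finite, and nonempty for n > 0, so the supremum is
   then a maximum.  On R[i] the modulus `|z| is itself an element of R[i]. *)
Definition spectral_radius (R : realType) (n : nat) (A : 'M[R]_n) : R :=
  sup [set r : R | exists z : R[i],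
         eigenvalue (map_mx (real_complex R) A) z /\ `|z| = r%:C].

(* P A P^T = [E F; 0 G] for some permutation matrix P, with E of order k and
   G of order n - k, both nonempty.  Under this convention every matrix of
   order 1, including zero, is irreducible. *)
Definition reducible_mx (R : realType) (n : nat) (A : 'M[R]_n) : Prop :=
  exists (s : 'S_n) (k : nat), (0 < k < n)%N /\
    forall i j : 'I_n, (k <= i)%N -> (j < k)%N ->
      (perm_mx s *m A *m (perm_mx s)^T) i j = 0.

Definition irreducible_mx (R : realType) (n : nat) (A : 'M[R]_n) : Prop :=
  ~ reducible_mx A.

Definition mx22 (R : realType) (x00 x01 x10 x11 : R) : 'M[R]_2 :=
  \matrix_(i < 2, j < 2)
    if i == 0 then (if j == 0 then x00 else x01)
              else (if j == 0 then x10 else x11).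

Definition T_GRMS (R : realType) (n : nat)
    (B H Q M N Q1 Q2 : 'M[R]_n) (theta : R) : 'M[R]_2 :=
  let a := norm2 (invmx M *m N) in
  let c := norm2 (invmx M *m B *m Q) in
  let d := norm2 (invmx Q1 *m Q2) in
  let alpha := norm2 (invmx Q1) in
  let beta := norm2 (invmx Q1 *m H) in
  mx22 a
       c
       (a * (theta * alpha + beta) + beta)
       (c * (theta * alpha + beta) + theta * d + `|1 - theta|).

Definition T_MGSOR (R : realType) (n : nat)
    (A B Qh : 'M[R]_n) (ah bh : R) : 'M[R]_2 :=
  let p := norm2 (invmx A *m B *m Qh) in
  let q := norm2 (invmx Qh) in
  mx22 `|1 - ah|
       (ah * p)
       (bh * `|1 - ah| * q)
       (ah * bh * p * q + `|1 - bh|).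

(* Main.v *)
Require Import Defs.
From mathcomp Require Import all_boot all_order all_algebra all_fingroup.
From mathcomp Require Import complex.
From mathcomp Require Import classical_sets reals.
From mathcomp Require Import boolp ring lra.

(** The spectral radius of a nonnegative matrix [a b; c d] of order 2 is the
    real number r >= max(a, d) with (r - a) (r - d) = b c
    ([spectral_radius_mx22]): this is the characteristic equation, its larger
    root dominates both diagonal entries, and the other root a + d - r is no
    larger in modulus.  Both conclusions follow from the monotonicity of
    t |-> (t - a) (t - d) on [max(a, d), +oo[.

    The first conclusion compares two such matrices entrywise
    ([spectral_radius_mx22_ltr]).  The bounds on theta say exactly that T lies
    strictly below T_MGSOR in its second row: theta < Delta is the inequality
    between the entries in position (1, 0), while theta > mu and theta < nu
    are the inequality between the entries in position (1, 1) on the branches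
    theta <= 1 and theta >= 1 of |1 - theta|.  The first row is compared by
    the hypotheses on a and c.

    For the second conclusion, put u = |1 - ah|, v = |1 - bh| and
    x = ah bh p q.  The off-diagonal product of T_MGSOR is u x, and
    (1 - u) (1 - (v + x)) = (1 - u) (1 - v) - x + u x, so the hypothesis
    x < (1 - u) (1 - v) says that the characteristic polynomial is positive
    at 1.  As both diagonal entries are below 1 ([one_minus_product_lt1]), the
    point 1 lies beyond the larger root ([spectral_radius_mx22_lt1]). *)

Set Implicit Arguments.
Unset Strict Implicit.
Unset Printing Implicit Defensive.

Import Order.TTheory GRing.Theory Num.Theory.
Local Open Scope ring_scope.

(** Either the set of values has a supremum, which then bounds the value 0
    taken at the zero vector, or [sup] is 0 by convention. *)
Lemma norm2_ge0 (R : realType) (m n : nat) (A : 'M[R]_(m, n)) : 0 <= norm2 A.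
Proof.
rewrite /norm2; set E := (X in sup X).
have [supE|/sup_out->//] := pselect (has_sup E).
apply: (ub_le_sup (proj2 supE)); exists 0.
  by rewrite /= /vnorm2 big1 ?sqrtr0 // => i _; rewrite mxE expr0n.
by rewrite mulmx0 /vnorm2 big1 ?sqrtr0 // => i _; rewrite mxE expr0n.
Qed.

Lemma eigenvalue_mx2 (F : fieldType) (A : 'M[F]_2) (z : F) :
  eigenvalue A z = ((z - A 0 0) * (z - A 1 1) == A 0 1 * A 1 0).
Proof.
rewrite eigenvalue_root_char /root /char_poly (expand_det_row _ ord0).
rewrite !big_ord_recl big_ord0 /cofactor !det_mx11 !mxE /=.
rewrite -[RHS]subr_eq0; congr (_ == _).
have -> : lift 0 0 = 1 :> 'I_2 by apply/val_inj.
have -> : lift 1 0 = 0 :> 'I_2 by apply/val_inj.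
by rewrite /= !hornerE /=; ring.
Qed.

(** A number r above both diagonal entries is the larger root of the
    characteristic polynomial; the other root is a + d - r, of modulus at most
    r because 0 <= a + d <= 2 r.  So both eigenvalues are real and the
    supremum of their moduli is attained at r. *)
Lemma spectral_radius_mx22 (R : realType) (a b c d r : R) :
    0 <= a -> 0 <= d -> a <= r -> d <= r -> (r - a) * (r - d) = b * c ->
  spectral_radius (mx22 a b c d) = r.
Proof.
move=> a0 d0 ar dr rE.
rewrite /spectral_radius; set E := (X in sup X).
have r0 : 0 <= r by lra.
have Er : E r.
  exists (r%:C)%C; split; last first.
    by rewrite normc_def /= expr0n addr0 sqrtr_sqr ger0_norm.
  by rewrite eigenvalue_mx2 !mxE /= -!rmorphB -!rmorphM rE.
have ubE : ubound E r.
  move=> s [z [/[!eigenvalue_mx2]/[!mxE]/= /eqP zE zs]].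
  have : (z - r%:C%C) * (z - (a + d - r)%:C%C) = 0.
    have <- : (z - a%:C%C) * (z - d%:C%C) - (b * c)%:C%C = 0.
      by rewrite zE rmorphM subrr.
    by rewrite -rE !(rmorphM, rmorphB, rmorphD); ring.
  move/eqP; rewrite mulf_eq0 !subr_eq0 => zr.
  have [x xr zx] : exists2 x : R, `|x| <= r & z = x%:C%C.
    case/orP: zr => /eqP->; first by exists r => //; rewrite ger0_norm.
    by exists (a + d - r) => //; rewrite ler_norml; lra.
  move: zs; rewrite zx normc_def /= expr0n addr0 sqrtr_sqr => -[<-].
  exact: xr.
apply/eqP; rewrite eq_le; apply/andP; split.
  by apply: ge_sup => //; exists r.
by apply: ub_le_sup => //; exists r.
Qed.

(** The discriminant (a - d)^2 + 4 b c is at least (a - d)^2, which places the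
    larger root above both a and d. *)
Lemma perron_root2 (R : rcfType) (a b c d : R) : 0 <= b -> 0 <= c ->
  exists r, [/\ a <= r, d <= r & (r - a) * (r - d) = b * c].
Proof.
move=> b0 c0; have bc0 : 0 <= b * c by exact: mulr_ge0.
set D := (a - d) ^+ 2 + 4 * (b * c).
have D0 : 0 <= D by rewrite /D addr_ge0 ?sqr_ge0 ?mulr_ge0.
have adD : `|a - d| <= Num.sqrt D.
  by rewrite -sqrtr_sqr ler_wsqrtr // /D lerDl mulr_ge0.
have [ad da] : a - d <= Num.sqrt D /\ - Num.sqrt D <= a - d.
  by move: adD; rewrite ler_norml => /andP[].
exists ((a + d + Num.sqrt D) / 2); split; [lra | lra |].
have -> : ((a + d + Num.sqrt D) / 2 - a) * ((a + d + Num.sqrt D) / 2 - d)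
   = (Num.sqrt D ^+ 2 - (a - d) ^+ 2) / 4 by field.
by rewrite sqr_sqrtr // /D; field.
Qed.

(** If r' were at most r, then 0 <= r' - a' <= r - a and likewise for d, so
    b' c' = (r' - a') (r' - d') <= (r - a) (r - d) = b c, against the strict
    growth of the off-diagonal product. *)
Lemma spectral_radius_mx22_ltr (R : realType) (a b c d a' b' c' d' : R) :
    0 <= a -> 0 <= b -> 0 <= c -> 0 <= d ->
    a < a' -> b < b' -> c < c' -> d < d' ->
  spectral_radius (mx22 a b c d) < spectral_radius (mx22 a' b' c' d').
Proof.
move=> a0 b0 c0 d0 aa bb cc dd.
have [r [ar dr rE]] := perron_root2 a d b0 c0.
have [|//|r' [ar' dr' rE']] := @perron_root2 _ a' b' c' d'; [lra | lra |].
rewrite (spectral_radius_mx22 _ _ _ _ rE) //.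
rewrite (spectral_radius_mx22 _ _ _ _ rE') //; try lra.
rewrite ltNge; apply/negP => r'r.
have : b * c < b' * c' by apply: ltr_pM.
suff : (r' - a') * (r' - d') <= (r - a) * (r - d) by lra.
by apply: ler_pM; lra.
Qed.

(** A root r >= 1 would give b c = (r - a) (r - d) >= (1 - a) (1 - d). *)
Lemma spectral_radius_mx22_lt1 (R : realType) (a b c d : R) :
    0 <= a -> 0 <= b -> 0 <= c -> 0 <= d ->
    a < 1 -> d < 1 -> b * c < (1 - a) * (1 - d) ->
  spectral_radius (mx22 a b c d) < 1.
Proof.
move=> a0 b0 c0 d0 a1 d1 bc.
have [r [ar dr rE]] := perron_root2 a d b0 c0.
rewrite (spectral_radius_mx22 _ _ _ _ rE) // ltNge; apply/negP => r1.
have : (1 - a) * (1 - d) <= (r - a) * (r - d) by apply: ler_pM; lra.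
lra.
Qed.

(** Positivity of (1 - u) (1 - v) leaves two cases, both factors positive or
    both negative; the condition u v < 1 excludes the second.  Then
    x < (1 - u) (1 - v) <= 1 - v. *)
Lemma one_minus_product_lt1 (R : realFieldType) (u v x : R) :
    0 <= x -> 0 <= u -> 0 <= v -> u * v < 1 -> x < (1 - u) * (1 - v) ->
  u < 1 /\ v + x < 1.
Proof.
move=> x0 u0 v0 uv1 xuv; have uv0 := le_lt_trans x0 xuv.
have u1 : u < 1.
  rewrite ltNge; apply/negP => u1.
  (* the two factors have the same sign, so v would exceed 1 as well *)
  have v1 : 1 < v by rewrite ltNge; apply/negP => v1; nra.
  nra.
by split=> //; have : 0 < 1 - v; nra.
Qed.

Theorem theorem3 (R : realType) (n : nat)
    (A B H Q M N Q1 Q2 Qh : 'M[R]_n) (ah bh theta : R)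
    (a c d alpha beta p q mu nu Delta : R)
    (hA : A \in unitmx)
    (hAMN : A = M - N) (hM : M \in unitmx)
    (hQ : Q = Q1 - Q2) (hQ1 : Q1 \in unitmx)
    (hQh : Qh \in unitmx)
    (hah : 0 < ah) (hbh : 0 < bh) (htheta : 0 < theta)
    (ha : a = norm2 (invmx M *m N))
    (hc : c = norm2 (invmx M *m B *m Q))
    (hd : d = norm2 (invmx Q1 *m Q2))
    (halpha : alpha = norm2 (invmx Q1))
    (hbeta : beta = norm2 (invmx Q1 *m H))
    (hp : p = norm2 (invmx A *m B *m Qh))
    (hq : q = norm2 (invmx Qh))
    (hmu : mu = (1 + beta * c - (`|1 - bh| + ah * bh * p * q))
                / (1 - (alpha * c + d)))
    (hnu : nu = (1 - beta * c + `|1 - bh| + ah * bh * p * q)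
                / (1 + alpha * c + d))
    (hDelta : Delta = (bh * `|1 - ah| * q - (a + 1) * beta) / (a * alpha))
    (hmgsor1 : `|1 - ah| * `|1 - bh| < 1)
    (hmgsor2 : ah * bh * p * q < (1 - `|1 - ah|) * (1 - `|1 - bh|))
    (hirr : irreducible_mx (T_GRMS B H Q M N Q1 Q2 theta))
    (h1 : a < `|1 - ah|)
    (h2 : c < ah * p)
    (h3 : alpha * c + d < 1)
    (h4 : beta * ((a + 1) * (1 - d) - alpha * c)
            - bh * `|1 - ah| * q * (1 - alpha * c - d)
          < a * alpha * (`|1 - bh| + ah * bh * p * q - 1))
    (h5 : mu < theta)
    (h6 : theta < Num.min nu Delta) :
  spectral_radius (T_GRMS B H Q M N Q1 Q2 theta)
    < spectral_radius (T_MGSOR A B Qh ah bh)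
  /\ spectral_radius (T_MGSOR A B Qh ah bh) < 1.
Proof.
have a0 : 0 <= a by rewrite ha norm2_ge0.
have c0 : 0 <= c by rewrite hc norm2_ge0.
have d0 : 0 <= d by rewrite hd norm2_ge0.
have al0 : 0 <= alpha by rewrite halpha norm2_ge0.
have be0 : 0 <= beta by rewrite hbeta norm2_ge0.
have p0 : 0 <= p by rewrite hp norm2_ge0.
have q0 : 0 <= q by rewrite hq norm2_ge0.
rewrite /T_GRMS /T_MGSOR -ha -hc -hd -halpha -hbeta -hp -hq.
have ac0 : 0 <= alpha * c by exact: mulr_ge0.
have bc0 : 0 <= beta * c by exact: mulr_ge0.
have u0 := normr_ge0 (1 - ah); have v0 := normr_ge0 (1 - bh).
have X0 : 0 <= ah * bh * p * q by rewrite !mulr_ge0 // ltW.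
set u : R := `|1 - ah| in h1 h4 hDelta hmgsor1 hmgsor2 u0 *.
set v : R := `|1 - bh| in h4 hmu hnu hmgsor1 hmgsor2 v0 *.
set X : R := ah * bh * p * q in h4 hmu hnu hmgsor2 X0 *.
have [u1 vX1] := one_minus_product_lt1 X0 u0 v0 hmgsor1 hmgsor2.
split; last first.
  apply: spectral_radius_mx22_lt1; rewrite ?addr_ge0 ?mulr_ge0 //; try exact: ltW.
    by rewrite addrC.
  have -> : ah * p * (bh * u * q) = u * X by rewrite /X; ring.
  have -> : (1 - u) * (1 - (X + v)) = (1 - u) * (1 - v) - X + u * X by ring.
  by rewrite ltrDr subr_gt0.
move: h6; rewrite lt_min => /andP[hn hD].
(* Were a * alpha zero, the quotient Delta would be 0 by the convention on
   division by zero, and theta could not lie strictly between 0 and Delta. *)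
have aal : 0 < a * alpha.
  rewrite lt_def mulr_ge0 // andbT; apply/eqP => aal.
  by move: hD; rewrite hDelta aal invr0 mulr0 => /(lt_trans htheta); rewrite ltxx.
have {}hD : theta * (a * alpha) < bh * u * q - (a + 1) * beta.
  by move: hD; rewrite hDelta ltr_pdivlMr.
have {}hn : theta * (1 + alpha * c + d) < 1 - beta * c + v + X.
  by move: hn; rewrite hnu ltr_pdivlMr //; lra.
have {}hm : 1 + beta * c - (v + X) < theta * (1 - (alpha * c + d)).
  by move: h5; rewrite hmu ltr_pdivrMr //; lra.
have th0 := ltW htheta.
apply: spectral_radius_mx22_ltr;
  rewrite ?addr_ge0 ?mulr_ge0 ?addr_ge0 ?mulr_ge0 //; first lra.
by case: (ger0P (1 - theta)) => ?; lra.
Qed.
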